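(* Let $\mathcal G$ be a loopy grid all of whose cycles have length greater than $3$, with Gaussian nodal injection fluctuations. Let $i,j$ be distinct non-reference buses. (1) Under the DC power flow model, with $\Sigma_\theta^{-1}$ the inverse covariance matrix of the nodal phase angles: if $\Sigma_\theta^{-1}(i,j)<0$, then $(ij)$ is an edge of $\mathcal G$. (2) Under the linear coupled (LC) power flow model, with $\Sigma_{(v,\theta)}^{-1}=\begin{bmatrix} J_{vv} & J_{v\theta} \\ J_{\theta v} & J_{\theta\theta} \end{bmatrix}$ the inverse covariance matrix of the nodal voltage magnitudes and phase angles: if $J_{vv}(i,j)+J_{\theta\theta}(i,j)<0$, then $(ij)$ is an edge of $\mathcal G$.
   Context: Power grid: a finite connected simple undirected graph with $N$ non-reference buses and one reference bus; ''loopy'' means that cycles are present. Each line $(ij)$ has resistance $r_{ij}>0$ and reactance $x_{ij}>0$. Put $g_{ij}=\frac{r_{ij}}{r_{ij}^2+x_{ij}^2}$ and $\beta_{ij}=\frac{x_{ij}}{r_{ij}^2+x_{ij}^2}$. For edge weights $w$, the reduced weighted Laplacian $H_w\in\mathbb R^{N\times N}$ (indexed by non-reference buses) is: $H_w(i,i)=\sum_k w_{ik}$ (sum over all lines at $i$, including a line to the reference bus), $H_w(i,j)=-w_{ij}$ if $(ij)$ is a line between distinct non-reference buses, and $0$ otherwise. DC power flow model: $p=H_\beta\theta$, with $p\sim\mathcal N(0,\Sigma_p)$ the active injections, $\Sigma_p$ diagonal with positive diagonal entries (independent non-degenerate injections), and $\theta$ the phase angles; $\Sigma_\theta=H_\beta^{-1}\Sigma_pH_\beta^{-1}$.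 LC power flow model: $\begin{bmatrix} v \\ \theta \end{bmatrix}=M^{-1}\begin{bmatrix} p \\ q \end{bmatrix}$ with $M=\begin{bmatrix} H_g & H_\beta \\ H_\beta & -H_g \end{bmatrix}$ (invertible), where $p,q$ are active and reactive injections and $v,\theta$ are voltage magnitude deviations and phase angles at non-reference buses. Injections at different buses are independent: $(p,q)\sim\mathcal N(0,\Sigma_{(p,q)})$, $\Sigma_{(p,q)}=\begin{bmatrix} \Sigma_{pp} & \Sigma_{pq} \\ \Sigma_{qp} & \Sigma_{qq} \end{bmatrix}$ positive definite, each block diagonal, $\Sigma_{pq}=\Sigma_{qp}$. Then $\Sigma_{(v,\theta)}=M^{-1}\Sigma_{(p,q)}M^{-1}$; the blocks of its inverse are $N\times N$. *)

(* Defs.v *)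
From HB Require Import structures.
From mathcomp Require Export all_boot all_order all_algebra.
From mathcomp Require Export all_classical all_reals all_analysis.

Set Implicit Arguments.
Unset Strict Implicit.
Unset Printing Implicit Defensive.

Import Order.TTheory GRing.Theory Num.Theory.
Local Open Scope classical_set_scope.
Local Open Scope ring_scope.

(* Buses are the elements of [option 'I_N]: [None] is the reference bus and
   [Some i] is the non-reference bus [i]. The impedances carry information on
   lines only; their values elsewhere are unconstrained and never used. *)
Record grid (R : realType) (N : nat) := Grid {
  line : rel (option 'I_N);
  resistance : option 'I_N -> option 'I_N -> R;
  reactance : option 'I_N -> option 'I_N -> R;
  line_sym : symmetric line;
  line_irr : irreflexive line;
  line_connected : forall a b, connect line a b;
  resistance_sym : forall a b, line a b -> resistance a b = resistance b a;
  reactance_sym : forall a b, line a b -> reactance a b = reactance b a;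
  resistance_gt0 : forall a b, line a b -> 0 < resistance a b;
  reactance_gt0 : forall a b, line a b -> 0 < reactance a b }.

Section GridMatrices.
Context {R : realType} {N : nat}.
Variable G : grid R N.

(* [ucycle] also accepts sequences of size at most 2 (for instance a line
   traversed back and forth), which are not cycles of a simple graph. *)
Definition graph_cycle (c : seq (option 'I_N)) : Prop :=
  ucycle (line G) c /\ (2 < size c)%N.

Definition loopy : Prop := exists c, graph_cycle c.

Definition conductance a b : R :=
  resistance G a b / (resistance G a b ^+ 2 + reactance G a b ^+ 2).

Definition susceptance a b : R :=
  reactance G a b / (resistance G a b ^+ 2 + reactance G a b ^+ 2).

Definition reduced_laplacian (w : option 'I_N -> option 'I_N -> R) : 'M[R]_N :=
  \matrix_(i, j)
    if i == j then \sum_(k | line G (Some i) k) w (Some i) k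
    else if line G (Some i) (Some j) then - w (Some i) (Some j) else 0.

Definition H_g : 'M[R]_N := reduced_laplacian conductance.
Definition H_beta : 'M[R]_N := reduced_laplacian susceptance.

Definition lc_matrix : 'M[R]_(N + N) := block_mx H_g H_beta H_beta (- H_g).

End GridMatrices.

Definition positive_definite {R : realType} {n : nat} (A : 'M[R]_n) : Prop :=
  A^T = A /\ forall u : 'cV[R]_n, u != 0 -> 0 < (u^T *m A *m u) 0 0.

Section RandomVectors.
Context {d : measure_display} {T : measurableType d} {R : realType}.
Variable P : probability T R.

Definition rvec n (X : 'I_n -> {RV P >-> R}) (t : T) : 'cV[R]_n :=
  \col_i X i t.

Definition stack m n (X : 'I_m -> {RV P >-> R}) (Y : 'I_n -> {RV P >-> R})
    (k : 'I_(m + n)) : {RV P >-> R} :=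
  match fintype.split k with inl i => X i | inr j => Y j end.

Definition covariance_mx n (X : 'I_n -> {RV P >-> R}) : 'M[R]_n :=
  \matrix_(i, j) fine (covariance P (X i) (X j)).

(* The multivariate law N(0, S): every linear combination [a^T X] has the
   univariate law N(0, a^T S a). A zero variance is treated apart because
   [normal_prob m 0] is a junk value and not the Dirac mass at [m]. *)
Definition centered_gaussian n (X : 'I_n -> {RV P >-> R}) (S : 'M[R]_n) : Prop :=
  forall (a : 'cV[R]_n) (U : set R), measurable U ->
    let s2 := (a^T *m S *m a) 0 0 in
    pushforward P (fun t => \sum_i a i 0 * X i t) U =
      if s2 == 0 then \d_(0 : R) U else normal_prob 0 (Num.sqrt s2) U.

End RandomVectors.

(* Main.v *)
(* The injections are a linear image of the phases, p = H theta (resp.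
   (p, q) = M (v, theta)), with H and M symmetric and invertible, so the inverse
   covariance of the latter is H Sigma^-1 H (resp. M Sigma^-1 M).

   Since the blocks of Sigma are diagonal, so are those of its inverse, say A, B,
   B, C with A and C positive. In J_vv + J_theta,theta the terms in B cancel,
   which leaves H_g (A + C) H_g + H_beta (A + C) H_beta. For a nonnegative
   diagonal D, a reduced Laplacian H and distinct i, j that are not adjacent,
   (H D H)(i, j) = sum_k H(i, k) D_k H(k, j): the terms k = i and k = j vanish
   because H(i, j) = 0, and the others are products of two nonpositive entries.
   So a negative entry forces an edge.

   H_beta is positive definite because its quadratic form is the energy
   sum_(ab) w_ab (y_a - y_b)^2 with y = 0 at the reference bus, and the grid is
   connected. If M (v, theta) = 0, then the sum of the quadratic forms of H_beta
   at v and theta is 0, so M is invertible too. *)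
Require Import Defs.
From mathcomp Require Import measurable_realfun ring lra.

Import Order.TTheory GRing.Theory Num.Theory.
Import numFieldNormedType.Exports.
Local Open Scope classical_set_scope.
Local Open Scope ring_scope.

(** * Second moment of the centered normal law *)

Section NormalMoments.
Context {R : realType}.
Notation mu := (@lebesgue_measure R).

(** The Radon-Nikodym derivative of [normal_prob] equals [normal_pdf] almost everywhere, because
    both have the same integral over every measurable set. *)
Lemma ge0_integral_normal_prob (m s : R) (f : R -> \bar R) :
  (forall x, 0 <= f x)%E -> measurable_fun [set: R] f ->
  (\int[normal_prob m s]_x f x = \int[mu]_x (f x * (normal_pdf m s x)%:E))%E.
Proof.
move=> f0 mf; have dom := normal_prob_dominates m s.
rewrite -(Radon_Nikodym_SigmaFinite.change_of_variables dom)//.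
apply: ae_eq_integral => //.
- apply: emeasurable_funM => //.
  exact: measurable_int (Radon_Nikodym_SigmaFinite.f_integrable dom).
- apply: emeasurable_funM => //; apply/measurable_EFinP.
  exact: measurable_normal_pdf.
- apply: ae_eqe_mul2l; apply: integral_ae_eq => //.
  + exact: Radon_Nikodym_SigmaFinite.f_integrable.
  + by apply/measurable_EFinP; exact: measurable_normal_pdf.
  + by move=> E _ mE; rewrite -Radon_Nikodym_SigmaFinite.f_integral.
Qed.

(** This is the primitive form of the integration by parts of [x * (x * normal_fun 0 s x)]. *)
Lemma is_derive_normal_fun (s x : R) : s != 0 ->
  is_derive x 1 (fun x : R => - (s ^+ 2 * x * normal_fun 0 s x))
    ((x ^+ 2 - s ^+ 2) * normal_fun 0 s x).
Proof.
move=> s0; rewrite /normal_fun.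
apply: is_derive_eq.
rewrite /GRing.scale /= ?subr0 ?expr1 !mulr1.
by field.
Qed.

(** With [u = x ^+ 2 / (s ^+ 2 *+ 2)], the inequality [u <= expR u] bounds [expR (- u)] by [u^-1],
    which squeezes the opposite function between 0 and [2 * s ^+ 4 / x]. *)
Lemma cvg_mulr_normal_fun (s : R) : s != 0 ->
  - (s ^+ 2 * x * normal_fun 0 s x) @[x --> +oo] --> (0 : R).
Proof.
move=> s0.
have cvgV : 2 * s ^+ 4 * x^-1 @[x --> +oo] --> (0 : R).
  have /gtr0_cvgV0 idV : \forall x \near +oo, 0 < id x :> R.
    exact: nbhs_pinfty_gt.
  rewrite -[X in _ --> X](mulr0 (2 * s ^+ 4)).
  by apply: (@cvgMl_tmp R R +oo); exact/idV/cvg_id.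
rewrite -[X in _ --> X]oppr0; apply: cvgN.
apply: (squeeze_cvgr _ (cvg_cst _) cvgV).
near=> x.
have x0 : 0 < x by near: x; exact: nbhs_pinfty_gt.
have sx0 : 0 <= s ^+ 2 * x by rewrite mulr_ge0 ?sqr_ge0 ?ltW.
rewrite mulr_ge0 ?normal_fun_ge0//=.
rewrite /normal_fun subr0 mulNr expRN.
set u := x ^+ 2 / _.
have u0 : 0 < u by rewrite divr_gt0 ?exprn_gt0// pmulrn_lgt0// exprn_even_gt0.
rewrite (_ : 2 * s ^+ 4 / x = s ^+ 2 * x * u^-1); last first.
  by rewrite /u; field; rewrite s0 gt_eqF.
rewrite ler_wpM2l// lef_pV2 ?posrE ?expR_gt0//.
by apply: le_trans (expR_ge1Dx u); rewrite lerDr.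
Unshelve. all: by end_near. Qed.

Lemma continuous_normal_fun (m s : R) : continuous (normal_fun m s).
Proof.
move=> x; apply/differentiable_continuous/derivable1_diffP.
by rewrite /normal_fun.
Qed.

(** The integrands differ by the derivative [h] of [F], and [F] vanishes both at 0 and at
    infinity. *)
Lemma half_second_moment_normal_fun (s : R) : 0 < s ->
  (\int[mu]_(x in [set x | (0 <= x)%R]) (x ^+ 2 * normal_fun 0 s x)%:E =
   \int[mu]_(x in [set x | (0 <= x)%R]) (s ^+ 2 * normal_fun 0 s x)%:E)%E.
Proof.
move=> s_gt0; have s0 : s != 0 by rewrite gt_eqF.
pose F (x : R) : R := - (s ^+ 2 * x * normal_fun 0 s x).
pose f (x : R) : R := x ^+ 2 * normal_fun 0 s x.
pose g (x : R) : R := s ^+ 2 * normal_fun 0 s x.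
pose h (x : R) : R := (x ^+ 2 - s ^+ 2) * normal_fun 0 s x.
have dF (x : R) : is_derive x 1 F (h x) by exact: is_derive_normal_fun.
have dF' (x : R) : (F^`())%classic x = h x by rewrite derive1E; exact: derive_val.
have cF : continuous F.
  by move=> x; apply/differentiable_continuous/derivable1_diffP; exact: ex_derive.
have ch : continuous h.
  move=> x; apply: cvgM; last exact: continuous_normal_fun.
  by apply: cvgB; [exact: exprn_continuous|exact: cvg_cst].
have cNh : continuous (fun x => - h x) by move=> x; apply: cvgN; exact: ch.
have mh : measurable_fun setT h by exact: continuous_measurable_fun.
have mn := @measurable_normal_fun R 0 s.
have mf : measurable_fun setT f by exact: measurable_funM.
have mg : measurable_fun setT g by exact: measurable_funM.
have f0 x : 0 <= f x by rewrite mulr_ge0 ?sqr_ge0 ?normal_fun_ge0.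
have g0 x : 0 <= g x by rewrite mulr_ge0 ?sqr_ge0 ?normal_fun_ge0.
have h_ge0 x : s <= x -> 0 <= h x.
  move=> sx; rewrite mulr_ge0 ?normal_fun_ge0// subr_ge0 ler_sqr ?nnegrE ?(ltW s_gt0)//.
  exact: le_trans (ltW s_gt0) sx.
have h_le0 x : 0 <= x -> x <= s -> 0 <= - h x.
  move=> x0 xs; rewrite -mulNr mulr_ge0 ?normal_fun_ge0// opprB subr_ge0.
  by rewrite ler_sqr ?nnegrE ?(ltW s_gt0).
(* [h = F'] changes sign at [s], and the contributions of the two
   sides to the integrals of [f] and [g] compensate each other. *)
have inner : (\int[mu]_(x in `[0%R, s]) (- h x)%:E = (- F s)%:E)%E.
  rewrite (@continuous_FTC2 R _ (fun x => - F x))//.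
  - by rewrite /F mulr0 mul0r !oppr0 sube0.
  - exact: continuous_subspaceT.
  - split.
    + by move=> x _; exact: ex_derive.
    + by apply/cvg_at_right_filter; apply: cvgN; exact: cF.
    + by apply/cvg_at_left_filter; apply: cvgN; exact: cF.
  - by move=> x _; rewrite derive1N ?dF'//; exact: ex_derive.
have outer : (\int[mu]_(x in `[s, +oo[) (h x)%:E = (- F s)%:E)%E.
  rewrite (@ge0_continuous_FTC2y R _ F _ 0)//.
  - by rewrite sub0e.
  - exact: continuous_subspaceT.
  - exact: cvg_mulr_normal_fun.
  - by apply/cvg_at_right_filter/cF.
have splitE (k : R -> R) : (forall x, 0 <= k x) -> measurable_fun setT k ->
    (\int[mu]_(x in [set x | (0 <= x)%R]) (k x)%:E =
     \int[mu]_(x in `[0%R, s]) (k x)%:E + \int[mu]_(x in `[s, +oo[) (k x)%:E)%E.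
  move=> k0 mk; rewrite -set_itvcy (@itv_bndbnd_setU _ _ _ (BLeft s))//=; last first.
    by rewrite bnd_simp ltW.
  rewrite ge0_integral_setU//=; first last.
  - apply/disj_setPS => x /= []; rewrite !in_itv/= andbT => /andP[_ xs].
    by rewrite leNgt xs.
  - by move=> x _; rewrite lee_fin.
  - by apply/measurable_EFinP; exact: measurable_funTS.
  rewrite integral_itv_bndo_bndc//.
  by apply/measurable_EFinP; exact: measurable_funTS.
rewrite !splitE//.
(* Each side is written as a sum of nonnegative integrals, [g = f + (- h)] before [s] and
   [f = g + h] after it, so that no extended reals are subtracted. *)
have -> : (\int[mu]_(x in `[0%R, s]) (g x)%:E =
    \int[mu]_(x in `[0%R, s]) (f x)%:E + (- F s)%:E)%E.
  rewrite -inner -ge0_integralD//=.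
  - by apply: eq_integral => x _; rewrite -EFinD /f /g /h; congr EFin; ring.
  - by move=> x _; rewrite lee_fin.
  - by apply/measurable_EFinP; exact: measurable_funTS.
  - by move=> x; rewrite in_itv/= lee_fin => /andP[]; exact: h_le0.
  - by apply/measurable_EFinP/measurable_funTS; exact: measurable_funN.
have -> : (\int[mu]_(x in `[s, +oo[) (f x)%:E =
    \int[mu]_(x in `[s, +oo[) (g x)%:E + (- F s)%:E)%E.
  rewrite -outer -ge0_integralD//=.
  - by apply: eq_integral => x _; rewrite -EFinD /f /g /h; congr EFin; ring.
  - by move=> x _; rewrite lee_fin.
  - by apply/measurable_EFinP; exact: measurable_funTS.
  - by move=> x; rewrite in_itv/= andbT lee_fin; exact: h_ge0.
  - by apply/measurable_EFinP/measurable_funTS.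
by rewrite addeAC addeA.
Qed.

(** By evenness the half-line identity extends to the whole line, where it trades [x ^+ 2] for the
    constant [s ^+ 2]; the density has total mass 1. *)
Lemma second_moment_normal_prob (s : R) : 0 < s ->
  (\int[normal_prob 0 s]_x (x ^+ 2)%:E = (s ^+ 2)%:E)%E.
Proof.
move=> s_gt0; have s0 : s != 0 by rewrite gt_eqF.
have cn := continuous_normal_fun 0 s.
have mn := @measurable_normal_fun R 0 s.
rewrite ge0_integral_normal_prob; first last.
- by apply/measurable_EFinP; exact: measurable_funX.
- by move=> x; rewrite lee_fin sqr_ge0.
transitivity (\int[mu]_x ((normal_peak s)%:E * (x ^+ 2 * normal_fun 0 s x)%:E))%E.
  by apply: eq_integral => x _; rewrite normal_pdfE// -!EFinM mulrCA.
rewrite ge0_integralZl ?lee_fin ?normal_peak_ge0//; first last.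
- by move=> x _; rewrite lee_fin mulr_ge0 ?sqr_ge0 ?normal_fun_ge0.
- apply/measurable_EFinP; exact: measurable_funM.
rewrite ge0_symfun_integralT; first last.
- by move=> x /=; rewrite /normal_fun !subr0 !sqrrN.
- by move=> x; apply: cvgM; [exact: exprn_continuous|exact: cn].
- by move=> x; rewrite mulr_ge0 ?sqr_ge0 ?normal_fun_ge0.
rewrite half_second_moment_normal_fun// -ge0_symfun_integralT; first last.
- by move=> x /=; rewrite /normal_fun !subr0 !sqrrN.
- by move=> x; apply: cvgM; [exact: cvg_cst|exact: cn].
- by move=> x; rewrite mulr_ge0 ?sqr_ge0 ?normal_fun_ge0.
rewrite -ge0_integralZl ?lee_fin ?normal_peak_ge0//; first last.
- by move=> x _; rewrite lee_fin mulr_ge0 ?sqr_ge0 ?normal_fun_ge0.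
- by apply/measurable_EFinP; exact: measurable_funM.
transitivity (\int[mu]_x ((s ^+ 2)%:E * (normal_pdf 0 s x)%:E))%E.
  by apply: eq_integral => x _; rewrite normal_pdfE// -!EFinM mulrCA.
rewrite ge0_integralZl ?lee_fin ?sqr_ge0//; first last.
- by move=> x _; rewrite lee_fin normal_pdf_ge0.
- by apply/measurable_EFinP; exact: measurable_normal_pdf.
by rewrite integral_normal_pdf mule1.
Qed.
End NormalMoments.

(** * Covariance of Gaussian vectors *)

Section GaussianVectors.
Context {d : measure_display} {T : measurableType d} {R : realType}.
Variable P : probability T R.

(* The default measurable structure on [R] carried by random variables and the
   one of [measurableTypeR R] carried by [normal_prob] have the same measurable
   sets but are different instances, hence the detour through [mY] and [mX2']. *)
Lemma integral_sqr_centered_normal (Y : {RV P >-> R}) (s2 : R) : 0 <= s2 ->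
  (forall U, measurable U -> pushforward P Y U =
    if s2 == 0 then \d_(0 : R) U else normal_prob 0 (Num.sqrt s2) U) ->
  (\int[P]_t (Y t ^+ 2)%:E = s2%:E)%E.
Proof.
move=> s2_ge0 lawY.
have mX2 : measurable_fun [set: R] (fun x : R => (x ^+ 2)%:E).
  by apply/measurable_EFinP; exact: measurable_funX.
have [s20|s20] := eqVneq s2 0.
  rewrite -(@ge0_integral_distribution _ _ _ _ _ P Y (fun x => (x ^+ 2)%:E))//; last first.
    by move=> x; rewrite lee_fin sqr_ge0.
  rewrite (@eq_measure_integral _ _ _ _ (\d_(0 : R))).
    by rewrite integral_dirac//= diracT mul1e expr0n/= s20.
  by move=> U mU _; apply: etrans (lawY _ mU) _; rewrite s20 eqxx.
have s_gt0 : 0 < Num.sqrt s2 by rewrite sqrtr_gt0 lt0r s20.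
rewrite -[in RHS](sqr_sqrtr s2_ge0) -(second_moment_normal_prob _ s_gt0).
have mY : measurable_fun setT (Y : T -> measurableTypeR R).
  by move=> mT U mU; exact: (measurable_funP Y).
have mX2' : measurable_fun [set: measurableTypeR R] (fun x : R => (x ^+ 2)%:E).
  by move=> mR U mU; exact: (mX2 mR U).
have := @ge0_integral_pushforward _ _ T (measurableTypeR R) R Y mY P setT
  (fun x : R => (x ^+ 2)%:E) measurableT mX2'.
rewrite preimage_setT => <-; last by move=> x _; rewrite lee_fin sqr_ge0.
apply: eq_measure_integral => U mU _; apply: etrans (lawY _ mU) _.
by rewrite (negbTE s20).
Qed.

Lemma integral_sqr_lty_Lfun2 (Y : {RV P >-> R}) :
  (\int[P]_t (Y t ^+ 2)%:E < +oo)%E -> (Y : T -> R) \in Lfun P 2%:E.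
Proof.
move=> Y2; apply/andP; split; first exact: mfunP.
rewrite inE/= /finite_norm unlock/=.
apply: poweR_lty; apply: le_lt_trans Y2.
rewrite le_eqVlt; apply/orP; left; apply/eqP; apply: eq_integral => t _.
by rewrite powR_mulrn// real_normK ?num_real.
Qed.

(** The expectation depends only on the law, so it equals its own opposite; integrability makes it
    finite, hence 0. *)
Lemma expectation_symmetric_law (Y : {RV P >-> R}) :
  (Y : T -> R) \in Lfun P 1 ->
  (forall U, measurable U -> pushforward P Y U = pushforward P (\- Y)%R U) ->
  ('E_P[Y] = 0)%E.
Proof.
move=> Y1 lawN.
pose Y' : {RV P >-> R} := (\- Y)%R.
have iY : P.-integrable setT (EFin \o Y) by exact/Lfun1_integrable.
have iY' : P.-integrable setT (EFin \o Y').
  by apply/Lfun1_integrable; rewrite rpredN.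
have EY' : ('E_P[Y'] = - 'E_P[Y])%E.
  by rewrite unlock -integralN ?integrable_add_def.
have : ('E_P[Y] = 'E_P[Y'])%E.
  rewrite unlock.
  have mE : measurable_fun [set: R] (EFin \o @id R).
    exact/measurable_EFinP/measurable_id.
  rewrite -(@integral_distribution _ _ _ _ _ P Y (EFin \o @id R))//.
  rewrite -(@integral_distribution _ _ _ _ _ P Y' (EFin \o @id R))//.
  by apply: eq_measure_integral => U mU _; exact: lawN.
have : ('E_P[Y] \is a fin_num)%E by exact: expectation_fin_num.
rewrite EY'; case: ('E_P[Y])%E => // r _ [rE]; congr EFin.
by move: rE; rewrite -[LHS]/(r : R) => rE; lra.
Qed.

(** The vectors [a] and [- a] have the same quadratic form, so [Y] has a symmetric law and mean 0.
    Its variance is then its second moment. *)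
Lemma centered_gaussian_lincomb n (X : 'I_n -> {RV P >-> R}) (S : 'M[R]_n)
    (a : 'cV[R]_n) (Y : {RV P >-> R}) :
  centered_gaussian X S -> 0 <= (a^T *m S *m a) 0 0 ->
  (forall t, Y t = \sum_i a i 0 * X i t) ->
  [/\ (Y : T -> R) \in Lfun P 2%:E, ('E_P[Y] = 0)%E &
      ('V_P[Y] = ((a^T *m S *m a) 0 0)%:E)%E].
Proof.
move=> gX s2_ge0 YE.
have lawY U : measurable U -> pushforward P Y U =
    if (a^T *m S *m a) 0 0 == 0 then \d_(0 : R) U
    else normal_prob 0 (Num.sqrt ((a^T *m S *m a) 0 0)) U.
  move=> mU; rewrite -(gX a U mU); congr (pushforward P _ U).
  exact/funext.
have lawN U : measurable U -> pushforward P Y U = pushforward P (\- Y)%R U.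
  move=> mU; rewrite lawY//.
  have aN : (- a)^T = - a^T by apply/matrixP => i j; rewrite !mxE.
  have := gX (- a) U mU; rewrite /= aN !mulNmx mulmxN opprK => <-.
  congr (pushforward P _ U); apply/funext => t.
  by rewrite /= YE -sumrN; apply: eq_bigr => i _; rewrite mxE mulNr.
have sqrY := integral_sqr_centered_normal Y _ s2_ge0 lawY.
have Y2 : (Y : T -> R) \in Lfun P 2%:E.
  by apply: integral_sqr_lty_Lfun2; rewrite sqrY ltry.
have Y1 : (Y : T -> R) \in Lfun P 1 by apply: Lfun_subset12; rewrite ?fin_num_measure.
have EY := expectation_symmetric_law Y Y1 lawN.
split => //; rewrite varianceE// EY expe2 mule0 sube0.
by rewrite unlock -sqrY.
Qed.

(* Polarization: covariances are read off the variances of the [X i + X j]. *)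
Lemma covariance_centered_gaussian n (X : 'I_n -> {RV P >-> R}) (S : 'M[R]_n) :
  S^T = S -> (forall a : 'cV[R]_n, 0 <= (a^T *m S *m a) 0 0) ->
  centered_gaussian X S -> covariance_mx X = S.
Proof.
move=> S_sym S_psd gX; apply/matrixP => i j; rewrite mxE.
pose e k : 'cV[R]_n := delta_mx k 0.
have eS k l : ((e k)^T *m S *m e l) 0 0 = S k l.
  by rewrite /e trmx_delta -rowE -colE !mxE.
have XE k t : X k t = \sum_l e k l 0 * X l t.
  rewrite (bigD1 k)//= mxE !eqxx mul1r big1 ?addr0// => l lk.
  by rewrite mxE (negbTE lk) mul0r.
have [Xi2 _ Vi] :=
  centered_gaussian_lincomb n X S (e i) (X i) gX (S_psd _) (XE i).
have [Xj2 _ Vj] :=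
  centered_gaussian_lincomb n X S (e j) (X j) gX (S_psd _) (XE j).
pose XX : {RV P >-> R} := (X i \+ X j)%R.
have XXE t : XX t = \sum_l (e i + e j) l 0 * X l t.
  rewrite /XX/= (XE i) (XE j) -big_split/=; apply: eq_bigr => l _.
  by rewrite [in RHS]mxE mulrDl.
have [_ _ Vij] :=
  centered_gaussian_lincomb n X S (e i + e j) XX gX (S_psd _) XXE.
have := varianceD Xi2 Xj2.
rewrite -[X in variance _ X]/(XX : T -> R) Vij Vi Vj.
have Pfin : P setT \is a fin_num := fin_num_measure P _ measurableT.
(* Finiteness turns the variance identity into an equation over [R], which can be solved for the
   covariance. *)
have covfin : covariance P (X i) (X j) \is a fin_num.
  by rewrite covariance_fin_num ?Lfun2_mul_Lfun1 ?Lfun_subset12.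
rewrite -(fineK covfin) => -[].
have -> : (e i + e j)^T = (e i)^T + (e j)^T by apply/matrixP => k l; rewrite !mxE.
have addE (A B : 'M[R]_1) : (A + B) 0 0 = A 0 0 + B 0 0 by rewrite mxE.
rewrite !mulmxDl !mulmxDr !addE !eS.
have -> : S j i = S i j by rewrite -[in LHS]S_sym mxE.
move=> /=; lra.
Qed.

End GaussianVectors.

(** * Positive definite matrices *)

Section LinearAlgebra.
Context {R : realType}.

Lemma mulmx1_invmx n (A B : 'M[R]_n) : A *m B = 1%:M -> invmx A = B.
Proof.
move=> AB1; have [uA _] := mulmx1_unit AB1.
by rewrite -[LHS]mulmx1 -AB1 mulKmx.
Qed.

(** [kermx] is the kernel acting on row vectors, hence the passage to the transpose. *)
Lemma unitmx_ker0 n (A : 'M[R]_n) :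
  (forall u : 'cV_n, A *m u = 0 -> u = 0) -> A \in unitmx.
Proof.
move=> A0; rewrite -unitmx_tr -row_free_unit -kermx_eq0.
apply/eqP/row_matrixP => i; rewrite row0.
apply: trmx_inj; rewrite trmx0; apply: A0.
apply: trmx_inj; rewrite trmx_mul trmxK trmx0 -row_mul mulmx_ker.
exact: row0.
Qed.

Lemma positive_definite_unitmx n (A : 'M[R]_n) :
  positive_definite A -> A \in unitmx.
Proof.
move=> [_ A_gt0]; apply: unitmx_ker0 => u Au0; apply/eqP/negPn/negP => /A_gt0.
by rewrite -mulmxA Au0 mulmx0 mxE ltxx.
Qed.

Lemma positive_definite_ge0 n (A : 'M[R]_n) (u : 'cV_n) :
  positive_definite A -> 0 <= (u^T *m A *m u) 0 0.
Proof.
move=> [_ A_gt0]; have [->|/A_gt0/ltW//] := eqVneq u 0.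
by rewrite mulmx0 mxE.
Qed.

Lemma invmx_congruence n (A S : 'M[R]_n) :
  A \in unitmx -> S \in unitmx -> A^T = A ->
  invmx (invmx A *m S *m (invmx A)^T) = A *m invmx S *m A.
Proof.
move=> uA uS A_sym; apply: mulmx1_invmx; rewrite trmx_inv A_sym.
by rewrite -!mulmxA mulKmx// mulKVmx// mulVmx.
Qed.

Lemma quad_diag_mx n (a : 'rV[R]_n) (u v : 'cV_n) :
  (u^T *m diag_mx a *m v) 0 0 = \sum_k u k 0 * a 0 k * v k 0.
Proof. by rewrite mxE; apply: eq_bigr => k _; rewrite mul_mx_diag !mxE. Qed.

Lemma positive_definite_diag_mx n (a : 'rV[R]_n) :
  (forall k, 0 < a 0 k) -> positive_definite (diag_mx a).
Proof.
move=> a_gt0; split; first exact: tr_diag_mx.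
move=> u u0; rewrite quad_diag_mx.
have [k uk] : exists k, u k 0 != 0.
  apply/existsP; apply: contraNT u0; rewrite negb_exists => /forallP u0.
  by apply/eqP/colP => k; rewrite mxE; apply/eqP; rewrite -[_ == _]negbK u0.
have t_ge0 l : 0 <= u l 0 * a 0 l * u l 0.
  by rewrite mulrAC -expr2 mulr_ge0 ?sqr_ge0// ltW.
rewrite (bigD1 k)//= ltr_pwDl ?sumr_ge0//.
by rewrite mulrAC -expr2 mulr_gt0// exprn_even_gt0.
Qed.

Lemma invmx_diag_mx n (a : 'rV[R]_n) : (forall k, 0 < a 0 k) ->
  invmx (diag_mx a) = diag_mx (\row_k (a 0 k)^-1).
Proof.
move=> a_gt0; apply: mulmx1_invmx; rewrite mulmx_diag; apply/matrixP => k l.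
by rewrite !mxE mulfV// gt_eqF.
Qed.

(** Up to a permutation of coordinates the matrix is a direct sum of 2 by 2 matrices with diagonal
    [a 0 k], [c 0 k] and off-diagonal entry [b 0 k]. Each is positive definite and is inverted by
    the cofactor formula, with determinant [D k]. *)
Lemma invmx_block_diag_mx n (a b c : 'rV[R]_n) :
  positive_definite (block_mx (diag_mx a) (diag_mx b) (diag_mx b) (diag_mx c)) ->
  exists alpha beta gamma : 'rV[R]_n,
  [/\ forall k, 0 < alpha 0 k, forall k, 0 < gamma 0 k &
      invmx (block_mx (diag_mx a) (diag_mx b) (diag_mx b) (diag_mx c)) =
      block_mx (diag_mx alpha) (diag_mx beta) (diag_mx beta) (diag_mx gamma)].
Proof.
move=> [_ pd].
(* The form is restricted to the plane spanned by coordinate [k] of each half. *)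
have quad k (x y : R) : (x != 0) || (y != 0) ->
    0 < x ^+ 2 * a 0 k + x * y * b 0 k *+ 2 + y ^+ 2 * c 0 k.
  move=> xy0.
  pose e : 'cV[R]_n := delta_mx k 0; pose u := x *: e; pose v := y *: e.
  have sumD (z z' : R) (f : 'rV[R]_n) :
      ((z *: e)^T *m diag_mx f *m (z' *: e)) 0 0 = z * z' * f 0 k.
    rewrite quad_diag_mx (bigD1 k)//= !mxE !eqxx !mulr1 big1 ?addr0 1?mulrAC//.
    by move=> l lk; rewrite !mxE (negbTE lk) !mulr0.
  have /pd : col_mx u v != 0.
    apply: contraTneq xy0 => /eqP; rewrite col_mx_eq0 => /andP[/eqP u0 /eqP v0].
    have := congr1 (fun w : 'cV[R]_n => w k 0) u0.
    have := congr1 (fun w : 'cV[R]_n => w k 0) v0.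
    by rewrite /u /v !mxE !eqxx !mulr1 => -> ->; rewrite eqxx.
  rewrite tr_col_mx mul_row_block mul_row_col !mulmxDl.
  have addE (A B : 'M[R]_1) : (A + B) 0 0 = A 0 0 + B 0 0 by rewrite mxE.
  by rewrite !addE !sumD; congr (0 < _); ring.
have a_gt0 k : 0 < a 0 k.
  by have := quad k 1 0; rewrite oner_eq0 => /(_ isT); lra.
have c_gt0 k : 0 < c 0 k.
  by have := quad k 0 1; rewrite oner_eq0 orbT => /(_ isT); lra.
pose D k := a 0 k * c 0 k - b 0 k ^+ 2.
have D_gt0 k : 0 < D k.
  (* At this vector the form takes the value [c 0 k * D k], and [c 0 k] is already known to be
     positive. *)
  have := quad k (c 0 k) (- b 0 k); rewrite gt_eqF//= => /(_ isT).
  rewrite (_ : _ + _ = c 0 k * D k) ?pmulr_rgt0// /D; ring.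
exists (\row_k (c 0 k / D k)), (\row_k (- b 0 k / D k)), (\row_k (a 0 k / D k)).
split; [by move=> k; rewrite mxE divr_gt0..|].
apply: mulmx1_invmx; rewrite mulmx_block !mulmx_diag scalar_mx_block.
have D0 k : a 0 k * c 0 k - b 0 k ^+ 2 != 0 by rewrite gt_eqF ?D_gt0.
by congr block_mx; apply/matrixP => k l; rewrite !mxE;
  (have [->|_] := eqVneq k l; rewrite ?mulr0n ?addr0// !mulr1n /D; field; exact: D0).
Qed.

End LinearAlgebra.

(** * Reduced Laplacians *)

Lemma big_option (V : nmodType) (I : finType) (F : option I -> V) :
  \sum_a F a = F None + \sum_i F (Some i).
Proof.
rewrite (bigD1 None)//= (reindex_omap Some id); last by case.
by congr (_ + _); apply: eq_bigl => i; rewrite eqxx.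
Qed.

Section Laplacian.
Context {R : realType} {N : nat}.
Variables (G : grid R N) (w : option 'I_N -> option 'I_N -> R).
Hypothesis w_sym : forall a b, line G a b -> w a b = w b a.
Hypothesis w_gt0 : forall a b, line G a b -> 0 < w a b.
Notation L := (reduced_laplacian G w).

(** Extension by zero turns sums over lines into sums over all pairs of buses, and makes symmetry
    and nonnegativity hold for every pair. *)
Let W a b := if line G a b then w a b else 0.

Let W_sym a b : W a b = W b a.
Proof. by rewrite /W (line_sym G b a); case: ifP => // /w_sym. Qed.

Let W_ge0 a b : 0 <= W a b.
Proof. by rewrite /W; case: ifP => // /w_gt0/ltW. Qed.

Lemma reduced_laplacian_sym : L^T = L.
Proof.
apply/matrixP => i j; rewrite !mxE eq_sym; case: eqP => [->//|_].
by rewrite (line_sym G (Some j)); case: ifP => // /w_sym ->.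
Qed.

Lemma reduced_laplacian_offdiag_le0 i j : i != j -> L i j <= 0.
Proof.
move=> ij; rewrite mxE (negbTE ij); case: ifP => // /w_gt0 wij.
by rewrite oppr_le0 ltW.
Qed.

Lemma reduced_laplacian_offdiag0 i j :
  i != j -> ~~ line G (Some i) (Some j) -> L i j = 0.
Proof. by move=> ij nij; rewrite mxE (negbTE ij) (negbTE nij). Qed.

Definition grounded (x : 'cV[R]_N) (a : option 'I_N) : R :=
  if a is Some i then x i 0 else 0.

(** The factor 2 appears because the double sum meets each line in both directions. Exchanging the
    two summations gives a second expression of the form, and adding the two completes the
    squares. *)
Lemma reduced_laplacian_energy (x : 'cV[R]_N) :
  (x^T *m L *m x) 0 0 *+ 2 =
  \sum_a \sum_b W a b * (grounded x a - grounded x b) ^+ 2.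
Proof.
set y := grounded x.
(* On the diagonal the subtracted weight is 0, since no bus is joined to itself. *)
have LE i j : L i j = (\sum_b W (Some i) b) *+ (i == j) - W (Some i) (Some j).
  rewrite mxE /W; case: eqP => [->|_]; last by case: ifP; rewrite sub0r ?oppr0.
  by rewrite (line_irr G) subr0 big_mkcond.
have LxE i : (L *m x) i 0 = \sum_b W (Some i) b * (y (Some i) - y b).
  rewrite mxE; under eq_bigr do rewrite LE mulrBl.
  rewrite sumrB (bigD1 i)//= eqxx mulr1n [X in _ + X - _]big1 ?addr0 => [|j ji]; last first.
    by rewrite eq_sym (negbTE ji) mulr0n mul0r.
  (* The reference bus can be added to the sum because [y] is 0 there. *)
  have -> : \sum_j W (Some i) (Some j) * x j 0 = \sum_b W (Some i) b * y b.
    by rewrite big_option /= mulr0 add0r.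
  by rewrite mulr_suml -sumrB; apply: eq_bigr => b _; rewrite /y /=; ring.
have Q1 : (x^T *m L *m x) 0 0 = \sum_a \sum_b W a b * (y a * (y a - y b)).
  rewrite -mulmxA mxE [RHS]big_option /= [X in _ = X + _]big1 => [|b _].
    rewrite add0r; apply: eq_bigr => i _; rewrite mxE LxE mulr_sumr.
    by apply: eq_bigr => b _; rewrite mulrCA.
  by rewrite mul0r mulr0.
have Q2 : (x^T *m L *m x) 0 0 = \sum_a \sum_b W a b * (y b * (y b - y a)).
  rewrite Q1 exchange_big; apply: eq_bigr => a _; apply: eq_bigr => b _ /=.
  by rewrite W_sym.
rewrite mulr2n {1}Q1 Q2 -big_split; apply: eq_bigr => a _.
by rewrite -big_split; apply: eq_bigr => b _ /=; ring.
Qed.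

Lemma positive_definite_reduced_laplacian : positive_definite L.
Proof.
split; first exact: reduced_laplacian_sym.
move=> x; apply: contra_neqT; rewrite -leNgt => Q_le0.
set y := grounded x.
have t_ge0 a b : 0 <= W a b * (y a - y b) ^+ 2 by rewrite mulr_ge0 ?sqr_ge0.
have E0 : \sum_a \sum_b W a b * (y a - y b) ^+ 2 = 0.
  apply/eqP; rewrite eq_le -reduced_laplacian_energy pmulrn_lle0// Q_le0.
  rewrite reduced_laplacian_energy; apply: sumr_ge0 => a _; exact: sumr_ge0.
have yE a b : line G a b -> y a = y b.
  move=> ab; have inner0 : \sum_c W a c * (y a - y c) ^+ 2 = 0.
    by apply: (psumr_eq0P _ E0) => // c _; exact: sumr_ge0.
  have /eqP := psumr_eq0P (fun c _ => t_ge0 a c) inner0 (i := b) isT.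
  rewrite /W ab mulf_eq0 gt_eqF ?w_gt0//= expf_eq0/= subr_eq0.
  by move=> /eqP.
(* The buses where [y] takes its reference value form a set closed under lines, so by connectedness
   it contains every bus. *)
have y0 a : y a = y None.
  have : fingraph.closed (line G) [pred b | y b == y None].
    by move=> b c /yE bc; rewrite !inE bc.
  move=> /closed_connect/(_ _ _ (line_connected G a None)).
  by rewrite !inE eqxx => /eqP.
by apply/colP => i; have := y0 (Some i); rewrite /y/= mxE.
Qed.

(** Diagonal entries of [L], the only ones that can be positive, occur in the product only at
    [k = i] and [k = j], where the other factor is the zero entry [L i j]. *)
Lemma laplacian_congruence_ge0 (a : 'rV[R]_N) i j :
  (forall k, 0 <= a 0 k) -> i != j -> ~~ line G (Some i) (Some j) ->
  0 <= (L *m diag_mx a *m L) i j.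
Proof.
move=> a_ge0 ij nij; have L0 := reduced_laplacian_offdiag0 i j ij nij.
rewrite mxE; apply: sumr_ge0 => k _; rewrite mul_mx_diag mxE.
have [->|ki] := eqVneq k i; first by rewrite L0 mulr0.
have [->|kj] := eqVneq k j; first by rewrite L0 !mul0r.
rewrite mulrAC mulr_ge0// mulr_le0// reduced_laplacian_offdiag_le0//.
by rewrite eq_sym.
Qed.

End Laplacian.

(** For a kernel vector with halves [v] and [t], the first block equation is paired with [t] and the
    second with [v]. In the sum the terms in [A] cancel by symmetry, leaving two nonnegative forms
    in [B] with sum 0. *)
Lemma block_mx_unitmx {R : realType} {N : nat} (A B : 'M[R]_N) :
  A^T = A -> positive_definite B -> block_mx A B B (- A) \in unitmx.
Proof.
move=> A_sym B_pd; apply: unitmx_ker0 => u.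
rewrite -[u]vsubmxK; set v := usubmx u; set t := dsubmx u.
rewrite mul_block_col => /eqP; rewrite col_mx_eq0 => /andP[/eqP e1 /eqP e2].
have addE (C D : 'M[R]_1) : (C + D) 0 0 = C 0 0 + D 0 0 by rewrite mxE.
have swap : (t^T *m A *m v) 0 0 = (v^T *m A *m t) 0 0.
  have tr11 (C : 'M[R]_1) : C 0 0 = C^T 0 0 by rewrite mxE.
  by rewrite tr11 !trmx_mul trmxK A_sym mulmxA.
have E : (t^T *m B *m t) 0 0 + (v^T *m B *m v) 0 0 = 0.
  have := congr1 (fun z : 'cV[R]_N => (t^T *m z) 0 0) e1.
  have := congr1 (fun z : 'cV[R]_N => (v^T *m z) 0 0) e2.
  have oppE (C : 'M[R]_1) : (- C) 0 0 = - C 0 0 by rewrite mxE.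
  have zeroE : (0 : 'M[R]_1) 0 0 = 0 by rewrite mxE.
  rewrite !mulmxDr !addE !mulmx0 !mulmxA mulmxN mulNmx oppE zeroE swap.
  lra.
have tB := positive_definite_ge0 _ _ t B_pd.
have vB := positive_definite_ge0 _ _ v B_pd.
have t0 : t = 0.
  by apply/eqP/negPn/negP => /(B_pd.2); lra.
have v0 : v = 0.
  by apply/eqP/negPn/negP => /(B_pd.2); lra.
by rewrite t0 v0 col_mx0.
Qed.

(** * Symmetry and positivity of the line weights *)

Section GridWeights.
Context {R : realType} {N : nat}.
Variable G : grid R N.

Lemma conductance_sym a b : line G a b -> conductance G a b = conductance G b a.
Proof.
by move=> ab; rewrite /conductance (resistance_sym ab) (reactance_sym ab).
Qed.

Lemma susceptance_sym a b : line G a b -> susceptance G a b = susceptance G b a.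
Proof.
by move=> ab; rewrite /susceptance (resistance_sym ab) (reactance_sym ab).
Qed.

Lemma conductance_gt0 a b : line G a b -> 0 < conductance G a b.
Proof.
by move=> ab; rewrite divr_gt0 ?addr_gt0 ?exprn_gt0 ?resistance_gt0 ?reactance_gt0.
Qed.

Lemma susceptance_gt0 a b : line G a b -> 0 < susceptance G a b.
Proof.
by move=> ab; rewrite divr_gt0 ?addr_gt0 ?exprn_gt0 ?resistance_gt0 ?reactance_gt0.
Qed.

End GridWeights.

(** * Linear images of Gaussian vectors and their inverse covariances *)

Section GaussianTransfer.
Context {d : measure_display} {T : measurableType d} {R : realType}.
Variable P : probability T R.

Lemma rvec_stack m n (X : 'I_m -> {RV P >-> R}) (Y : 'I_n -> {RV P >-> R}) t :
  rvec (stack X Y) t = col_mx (rvec X t) (rvec Y t).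
Proof.
apply/matrixP => k l; rewrite !mxE /stack.
by case: (fintype.split k) => j; rewrite mxE.
Qed.

(** The combination of [Y] with coefficients [a] is the combination of [X] with coefficients
    [A^T *m a]. *)
Lemma centered_gaussian_linear m n (A : 'M[R]_(n, m)) (X : 'I_m -> {RV P >-> R})
    (Y : 'I_n -> {RV P >-> R}) (S : 'M[R]_m) :
  centered_gaussian X S -> (forall t, rvec Y t = A *m rvec X t) ->
  centered_gaussian Y (A *m S *m A^T).
Proof.
move=> gX YE a U mU s2.
have := gX (A^T *m a) U mU; rewrite /= trmx_mul trmxK.
have -> : a^T *m A *m S *m (A^T *m a) = a^T *m (A *m S *m A^T) *m a.
  by rewrite !mulmxA.
move=> <-; congr (pushforward P _ U); apply/funext => t.
have lincombE k (Z : 'I_k -> {RV P >-> R}) (b : 'cV[R]_k) :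
    \sum_i b i 0 * Z i t = (b^T *m rvec Z t) 0 0.
  by rewrite mxE; apply: eq_bigr => i _; rewrite !mxE.
by rewrite !lincombE YE trmx_mul trmxK mulmxA.
Qed.

(** This serves both models, with [A] equal to [H_beta G] for DC and to [lc_matrix G] for LC. *)
Lemma invmx_covariance_linear n (A S : 'M[R]_n) (X Y : 'I_n -> {RV P >-> R}) :
  A^T = A -> A \in unitmx -> positive_definite S -> centered_gaussian X S ->
  (forall t, rvec Y t = invmx A *m rvec X t) ->
  invmx (covariance_mx Y) = A *m invmx S *m A.
Proof.
move=> A_sym uA S_pd gX YE; have gY := centered_gaussian_linear _ _ _ _ _ _ gX YE.
rewrite (covariance_centered_gaussian _ _ _ _ _ _ gY).
- exact: invmx_congruence (positive_definite_unitmx _ _ S_pd) A_sym.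
- by rewrite !trmx_mul trmxK S_pd.1 mulmxA.
- move=> a; have := positive_definite_ge0 _ _ ((invmx A)^T *m a) S_pd.
  by rewrite trmx_mul trmxK !mulmxA.
Qed.

End GaussianTransfer.

(** * Adjacency from negative entries of the inverse covariance *)

Theorem corollary1 (R : realType) (N : nat) (G : grid R N)
    (G_loopy : loopy G)
    (G_girth : forall c, graph_cycle G c -> (3 < size c)%N)
    (i j : 'I_N) (ij_distinct : i != j)
    (d : measure_display) (T : measurableType d) (P : probability T R) :
  (forall (p theta : 'I_N -> {RV P >-> R}) (Sigma_p : 'M[R]_N),
      is_diag_mx Sigma_p ->
      (forall k, 0 < Sigma_p k k) ->
      centered_gaussian p Sigma_p ->
      (forall t, rvec p t = H_beta G *m rvec theta t) ->
      invmx (covariance_mx theta) i j < 0 ->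
      line G (Some i) (Some j))
  /\
  (forall (p q v theta : 'I_N -> {RV P >-> R})
      (Sigma_pp Sigma_pq Sigma_qp Sigma_qq : 'M[R]_N),
      let Sigma := block_mx Sigma_pp Sigma_pq Sigma_qp Sigma_qq in
      is_diag_mx Sigma_pp -> is_diag_mx Sigma_pq ->
      is_diag_mx Sigma_qp -> is_diag_mx Sigma_qq ->
      Sigma_pq = Sigma_qp ->
      positive_definite Sigma ->
      centered_gaussian (stack p q) Sigma ->
      (forall t, col_mx (rvec v t) (rvec theta t) =
                 invmx (lc_matrix G) *m col_mx (rvec p t) (rvec q t)) ->
      let J := invmx (covariance_mx (stack v theta)) in
      ulsubmx J i j + drsubmx J i j < 0 ->
      line G (Some i) (Some j)).
Proof.
have Hg_sym : (H_g G)^T = H_g G.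
  by apply: reduced_laplacian_sym; exact: conductance_sym.
have Hb_pd : positive_definite (H_beta G).
  apply: positive_definite_reduced_laplacian.
  - exact: susceptance_sym.
  - exact: susceptance_gt0.
have Hb_sym := Hb_pd.1.
(* Both claims are proved by contraposition, so these bounds are stated for non-adjacent [i] and
   [j]. *)
have g_ge0 (a : 'rV[R]_N) : (forall k, 0 <= a 0 k) ->
    ~~ line G (Some i) (Some j) -> 0 <= (H_g G *m diag_mx a *m H_g G) i j.
  by move=> ? ?; apply: laplacian_congruence_ge0 => //; exact: conductance_gt0.
have b_ge0 (a : 'rV[R]_N) : (forall k, 0 <= a 0 k) ->
    ~~ line G (Some i) (Some j) -> 0 <= (H_beta G *m diag_mx a *m H_beta G) i j.
  by move=> ? ?; apply: laplacian_congruence_ge0 => //; exact: susceptance_gt0.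
split.
  move=> p theta S /diag_mxP[s ->] s_gt0 gp pE; apply: contraLR => nij.
  have {}s_gt0 k : 0 < s 0 k by have := s_gt0 k; rewrite mxE eqxx.
  have Hb_unit := positive_definite_unitmx _ _ Hb_pd.
  have thetaE t : rvec theta t = invmx (H_beta G) *m rvec p t.
    by rewrite pE mulKmx.
  rewrite (invmx_covariance_linear P _ _ _ _ _ Hb_sym Hb_unit _ gp thetaE);
    last exact: positive_definite_diag_mx.
  rewrite invmx_diag_mx// -leNgt; apply: b_ge0 => // k.
  by rewrite mxE invr_ge0 ltW.
move=> p q v theta Spp Spq Sqp Sqq S /diag_mxP[a aE] /diag_mxP[b bE] _.
move=> /diag_mxP[c cE] SpqE S_pd gpq vE J; apply: contraLR => nij.
have SE : S = block_mx (diag_mx a) (diag_mx b) (diag_mx b) (diag_mx c).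
  by rewrite /S -SpqE aE bE cE.
have M_unit : lc_matrix G \in unitmx by exact: block_mx_unitmx.
have M_sym : (lc_matrix G)^T = lc_matrix G.
  by rewrite /lc_matrix tr_block_mx linearN/= Hg_sym Hb_sym.
have yE t : rvec (stack v theta) t = invmx (lc_matrix G) *m rvec (stack p q) t.
  by rewrite !rvec_stack.
have JE := invmx_covariance_linear P _ _ _ _ _ M_sym M_unit S_pd gpq yE.
rewrite SE in S_pd.
have [al [be [ga [al_gt0 ga_gt0 invE]]]] := invmx_block_diag_mx _ _ _ _ S_pd.
rewrite /J JE SE invE /lc_matrix !mulmx_block block_mxKul block_mxKdr -leNgt.
have -> : forall A B : 'M[R]_N, A i j + B i j = (A + B) i j.
  by move=> A B; rewrite [RHS]mxE.
set Hg := H_g G; set Hb := H_beta G.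
(* The block [- Hg] gives the cross terms in [be] opposite signs in the two diagonal blocks. Their
   cancellation is essential, because [be] has no known sign. *)
have -> : (Hg *m diag_mx al + Hb *m diag_mx be) *m Hg +
    (Hg *m diag_mx be + Hb *m diag_mx ga) *m Hb +
    ((Hb *m diag_mx al + - Hg *m diag_mx be) *m Hb +
    (Hb *m diag_mx be + - Hg *m diag_mx ga) *m - Hg) =
    Hg *m diag_mx (al + ga) *m Hg + Hb *m diag_mx (al + ga) *m Hb.
  rewrite !raddfD /= !(mulmxDl, mulmxDr, mulNmx, mulmxN) ?opprK.
  have cancel (x1 x2 x3 x4 x5 x6 : 'M[R]_N) :
      x1 + x2 + (x3 + x4) + (x5 - x3 + (- x2 + x6)) = x1 + x6 + (x5 + x4).
    by apply/matrixP => k l; rewrite !mxE; ring.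
  exact: cancel.
have sum_ge0 k : 0 <= (al + ga) 0 k by rewrite mxE addr_ge0 ?ltW.
by rewrite mxE addr_ge0 ?g_ge0 ?b_ge0.
Qed.
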